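(* Let $(I_k)_{k\in K}$ be a family of sets, and for every $k\in K$ let $R_k\subseteq I_k\times I_k$ with incidence matrix $M_{R_k}=[a^{(k)}_{ij}]_{i,j\in I_k}$. Put $I:=\prod_{k\in K}I_k$ and $R:=\prod_{k\in K}R_k$. Then $R\subseteq I\times I$, and, writing $M_R=[a_{ij}]_{i,j\in I}$ for the incidence matrix of $R$, we have \[ a_{(i_k)_{k\in K}\,(j_k)_{k\in K}}=\min_{k\in K}a^{(k)}_{i_kj_k} \] for all $(i_k)_{k\in K},(j_k)_{k\in K}\in I$.
   Context: For a set $J$ and a relation $Q\subseteq J\times J$, the incidence matrix $M_Q=[q_{ij}]_{i,j\in J}$ is the mapping $J\times J\to\{0,1\}$ with $q_{ij}=1$ if $(i,j)\in Q$ and $q_{ij}=0$ otherwise. The product of the relations $R_k\subseteq I_k\times I_k$ ($k\in K$) is \[ \prod_{k\in K}R_k:=\{((i_k)_{k\in K},(j_k)_{k\in K})\in I\times I\mid (i_k,j_k)\in R_k\text{ for all }k\in K\}, \] where $I=\prod_{k\in K}I_k$. The minimum is taken in $\{0,1\}$ (so it is $1$ when all $a^{(k)}_{i_kj_k}$ are $1$, in particular for empty $K$, and $0$ otherwise). *)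

(* Defs.v *)
From mathcomp Require Import all_boot all_order.
From mathcomp Require Import boolp classical_sets.

Set Implicit Arguments.
Unset Strict Implicit.
Unset Printing Implicit Defensive.

Local Open Scope classical_set_scope.

(* The set {0,1} is 'I_2 with its usual order: ord0 is 0 and ord_max is 1. *)

Definition incidence_matrix (J : Type) (Q : set (J * J)) (i j : J) : 'I_2 :=
  if `[< Q (i, j) >] then ord_max else ord0.

Definition rel_prod (K : Type) (I : K -> Type)
    (R : forall k : K, set (I k * I k)) :
    set ((forall k : K, I k) * (forall k : K, I k)) :=
  [set p | forall k : K, R k (p.1 k, p.2 k)].

(* The least element of the family f, for an index type K of any size. A
   nonempty subset of 'I_2 always has a least element, so the default value 1
   of xget is used only when K is empty, where it is the convention for the
   minimum of the empty family in {0,1}. *)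
Definition family_min (K : Type) (f : K -> 'I_2) : 'I_2 :=
  xget ord_max (range f `&` lbound (range f)).

(* Main.v *)
Require Import Defs.
From mathcomp Require Import all_boot all_order.
From mathcomp Require Import boolp classical_sets.

Local Open Scope classical_set_scope.

(** Both sides take values in {0,1}, so it suffices to see when each is 1. If every pair of
    coordinates is related, all factor entries are 1 and so is their minimum ([family_min_max]).
    Otherwise, classically, some coordinate fails, and its entry 0 forces the minimum to 0
    ([family_min_0]). *)

Lemma ord2_neq_max (x : 'I_2) : x <> ord_max -> x = ord0.
Proof. by case: x => [[|[|//]] lt_x] neq_x; [|case: neq_x]; apply/val_inj. Qed.

(** A least element, if there is one, is a value of [f], hence 1; for empty [K] the default of
    [xget] is also 1. *)
Lemma family_min_max (K : Type) (f : K -> 'I_2) :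
  (forall k, f k = ord_max) -> family_min f = ord_max.
Proof.
by move=> f_max; rewrite /family_min; case: xgetP => // y -> [[k _ <-] _].
Qed.

Lemma family_min_0 (K : Type) (f : K -> 'I_2) (k : K) :
  f k = ord0 -> family_min f = ord0.
Proof.
move=> fk0; apply: xget_unique.
  by split=> [|y _]; [exists k | rewrite Order.OrdinalOrder.leEord].
(* Uniqueness: any lower bound of the range is at most [f k], that is, 0. *)
move=> y [_ /(_ (f k))]; rewrite fk0 => le_y0; apply/val_inj/eqP.
by rewrite -leqn0; apply: le_y0; exists k.
Qed.

Lemma incidence_matrix_max (J : Type) (Q : set (J * J)) (i j : J) :
  incidence_matrix Q i j = ord_max <-> Q (i, j).
Proof. by rewrite /incidence_matrix; case: asboolP. Qed.

Theorem theorem5 (K : Type) (I : K -> Type)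
    (R : forall k : K, set (I k * I k)) :
  rel_prod R `<=` [set: forall k : K, I k] `*` [set: forall k : K, I k] /\
  forall i j : (forall k : K, I k),
    incidence_matrix (rel_prod R) i j =
      family_min (fun k : K => incidence_matrix (R k) (i k) (j k)).
Proof.
split=> // i j; have [Rij|nRij] := pselect (rel_prod R (i, j)).
  rewrite family_min_max => [|k]; first exact/incidence_matrix_max.
  exact/incidence_matrix_max/Rij.
have /existsNP[k nRk] := nRij.
(* Both the entry of the product and the entry at [k] must be 0: a value 1 would contradict [nRij]
   or [nRk]. *)
by rewrite (family_min_0 _ _ k); apply: ord2_neq_max => /incidence_matrix_max.
Qed.
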